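(* Let $A \in \mathbb{C}^{N \times r}$ and let $r \le n \le N$. Let $\hat A \in \mathbb{C}^{n \times r}$ be a submatrix of $A$ (formed by $n$ of its rows) with nonzero volume, such that $\hat A$ has the maximal volume among all the $n \times r$ submatrices of $A$ which differ from $\hat A$ in a single row. Let $A_M \in \mathbb{C}^{n \times r}$ be an $n\times r$ submatrix of $A$ with the maximal volume among all $n \times r$ submatrices of $A$. Then $$\mathcal{V}_2(A_M) \le \mathcal{V}_2(\hat A) \cdot \left( \frac{n+1}{n-r+1} \right)^{r/2}.$$
   Context: The volume (2-volume) of a matrix $B \in \mathbb{C}^{n \times r}$ is $\mathcal{V}_2(B) = \prod_{i=1}^{\min(n,r)} \sigma_i(B)$, where $\sigma_i(B)$ are the singular values of $B$. An $n \times r$ submatrix of $A \in \mathbb{C}^{N\times r}$ is given by choosing $n$ distinct row indices of $A$ (all $r$ columns are kept). The maximality condition on $\hat A$ means that replacing any single row of $\hat A$ by any row of $A$ whose index is not among those of $\hat A$ does not increase the volume. *)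

(* Defs.v *)
From HB Require Import structures.
From mathcomp Require Import all_boot all_order all_algebra.
From mathcomp Require Import complex.
From mathcomp Require Import reals exp.

Set Implicit Arguments.
Unset Strict Implicit.
Unset Printing Implicit Defensive.

Import Order.TTheory GRing.Theory Num.Theory.
Local Open Scope ring_scope.
Local Open Scope sesquilinear_scope.

(* [B^t* *m B] is Hermitian positive semidefinite, so [spectral_diag] lists its
   eigenvalues with multiplicity and these are nonnegative reals: taking the
   real part only moves them from [R[i]] to [R]. The list has size [r]; when
   [n < r] its last [r - n] items are 0. *)
Definition singular_values (R : realType) (n r : nat) (B : 'M[R[i]]_(n, r)) :
    seq R :=
  sort >=%R
    [seq Num.sqrt (complex.Re (spectral_diag (B^t* *m B) 0 j)) | j : 'I_r].

Definition volume (R : realType) (n r : nat) (B : 'M[R[i]]_(n, r)) : R :=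
  \prod_(i < minn n r) (singular_values B)`_i.

(* Main.v *)
(* Since [r <= n], the squared volume is the determinant of the Gram matrix
   [B^t* *m B]. Right multiplication of [A] by an invertible [L] scales all
   squared volumes by the same factor, so one may assume that the Gram matrix
   of the dominant rows [H] is the identity. Put [G = A *m A^t*] and
   [w i = G i i]. Replacing row [k] of [H] by row [i] gives squared volume
   [(1 + w i) * (1 - w k) + `|G i k| ^+ 2], hence this is at most 1, while
   [\sum_(k in H) w k = r] and [\sum_(k in H) `|G i k| ^+ 2 = w i].
   Averaging over [k] bounds [\sum_(i in M) w i], the trace of the Gram matrix
   of the rows [M], by [r (n + 1) / (n - r + 1)], and AM-GM for the eigenvalues
   turns this into a bound on its determinant. *)
Require Import Defs.
From HB Require Import structures.
From mathcomp Require Import all_boot all_order all_algebra.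
From mathcomp Require Import complex.
From mathcomp Require Import reals exp.
From mathcomp Require Import ring lra.

Set Implicit Arguments.
Unset Strict Implicit.
Unset Printing Implicit Defensive.

Import Order.TTheory GRing.Theory Num.Theory.
Local Open Scope ring_scope.
Local Open Scope sesquilinear_scope.

(** * Real inequalities behind the averaging over swaps *)

(* [m], [t] and [u] stand for [#|H :\: M|], the total weight of [H :\: M] and
   the total weight of [M :\: H]. The last two hypotheses sum the swap condition
   over all of [H] and over [H :\: M] only: the former suffices when
   [r * (m - r) <= t * (n - r + 1)], the latter otherwise. *)
Lemma swap_arith (R : realFieldType) (n r m t u : R) :
  0 <= r -> r <= n -> m <= n -> 0 <= t -> t <= r -> 0 <= u ->
  u * (n - r + 1) <= m * r -> (m + u) * (m - t) <= m ^+ 2 ->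
  (r - t + u) * (n - r + 1) <= r * (n + 1).
Proof.
move=> r_ge0 le_rn le_mn t_ge0 le_tr u_ge0 u_le mu_le.
set q := n - r + 1 in u_le *.
(* Since [q + r = n + 1], the goal amounts to [(u - t) * q <= r ^+ 2]. *)
have [t_big|t_small] := leP (r * (m - r)) (t * q).
  by rewrite /q in t_big u_le *; nra.
have q_gt0 : 0 < q by rewrite /q; lra.
have lt_rm : r < m.
  rewrite ltNge; apply/negP => le_mr; have := mulr_ge0 t_ge0 (ltW q_gt0).
  by have := mulr_ge0 r_ge0 (_ : 0 <= r - m); nra.
have mt_gt0 : 0 < m - t by lra.
have sq_le : (m - r) ^+ 2 <= q * (m - t).
  have : (m - r) * m <= q * m by apply: ler_wpM2r; rewrite /q; lra.
  by nra.
(* After multiplication by [q], this is the square of [t_small] followed by [sq_le]. *)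
have : q * t ^+ 2 <= r ^+ 2 * (m - t).
  rewrite -(ler_pM2l q_gt0).
  have : (t * q) ^+ 2 <= (r * (m - r)) ^+ 2.
    by rewrite ler_pXn2r ?nnegrE ?mulr_ge0 //; lra.
  have : r ^+ 2 * (m - r) ^+ 2 <= r ^+ 2 * (q * (m - t)).
    by apply: ler_wpM2l => //; rewrite exprn_ge0.
  by nra.
move=> qt2_le.
(* The product hypothesis [mu_le] rearranges to [(u - t) * (m - t) <= t ^+ 2]. *)
have : q * (u - t) * (m - t) <= r ^+ 2 * (m - t).
  apply: le_trans qt2_le.
  rewrite -mulrA ler_pM2l //; nra.
rewrite ler_pM2r // => qut_le.
by rewrite /q in qut_le *; nra.
Qed.

(** Here [w i] abstracts [G i i] and [e i k] the squared modulus of [G i k]. The rows shared by [H]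
    and [M] weigh [r - t], so only [t] and [u] remain to be compared. *)
Lemma swap_sum_le (R : realFieldType) (I : finType) (H M : {set I}) (n r : nat)
    (w : I -> R) (e : I -> I -> R) :
  #|H| = n -> #|M| = n -> (r <= n)%N ->
  (forall i, 0 <= w i) -> (forall i k, 0 <= e i k) ->
  \sum_(k in H) w k = r%:R ->
  (forall i, \sum_(k in H) e i k = w i) ->
  (forall i k, i \notin H -> k \in H ->
     (1 + w i) * (1 - w k) + e i k <= 1) ->
  (\sum_(i in M) w i) * (n%:R - r%:R + 1) <= r%:R * (n%:R + 1).
Proof.
move=> cardH cardM le_rn w_ge0 e_ge0 sumH sume swapP.
pose m := #|H :\: M|.
have cardU : #|M :\: H| = m.
  have /eqP := cardsID H M; have /eqP := cardsID M H.
  by rewrite cardH cardM setIC => /eqP <- /eqP /addnI.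
have le_mn : (m <= n)%N by rewrite -cardH subset_leq_card ?subsetDl.
set t := \sum_(k in H :\: M) w k; set u := \sum_(i in M :\: H) w i.
have sumHM : \sum_(k in H :&: M) w k = r%:R - t.
  by move: sumH; rewrite (big_setID M) /= -/t => <-; rewrite addrK.
have t_ge0 : 0 <= t by apply: sumr_ge0.
have u_ge0 : 0 <= u by apply: sumr_ge0.
have le_tr : t <= r%:R by rewrite -subr_ge0 -sumHM sumr_ge0.
have -> : \sum_(i in M) w i = r%:R - t + u.
  by rewrite (big_setID H) /= setIC sumHM.
(* In the sum over [k] in [H], the terms [e i k] add up to one more [w i], which turns the factor
   [n - r] into [n - r + 1]. *)
have w_le i : i \notin H -> w i * (n%:R - r%:R + 1) <= r%:R.
  move=> iNH.
  have : \sum_(k in H) ((1 + w i) * (1 - w k) + e i k) <= \sum_(k in H) 1.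
    by apply: ler_sum => k kH; apply: swapP.
  rewrite big_split /= -mulr_sumr sumrB sumH sume sumr_const cardH.
  by nra.
apply: (@swap_arith _ _ _ m%:R); rewrite ?ler0n ?ler_nat //.
  rewrite mulr_suml mulr_natl -cardU -sumr_const; apply: ler_sum => i.
  by rewrite inE => /andP[iNH _]; apply: w_le.
(* The product inequality is summed over the [m ^+ 2] pairs of a new and a dropped row, where
   [e i k >= 0] is discarded. *)
have -> : m%:R + u = \sum_(i in M :\: H) (1 + w i).
  by rewrite big_split /= sumr_const cardU.
have -> : m%:R - t = \sum_(k in H :\: M) (1 - w k).
  by rewrite sumrB sumr_const.
have -> : m%:R ^+ 2 = \sum_(i in M :\: H) \sum_(k in H :\: M) 1 :> R.
  by rewrite !sumr_const cardU -/m -[RHS]mulr_natl expr2.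
rewrite mulr_suml; apply: ler_sum => i; rewrite inE => /andP[iNH _].
rewrite mulr_sumr; apply: ler_sum => k; rewrite inE => /andP[_ kH].
by apply: le_trans (swapP i k iNH kH); rewrite lerDl.
Qed.

(** * Determinant identities *)

(** Sylvester's identity: multiplying [Z] by the same unipotent block matrix on the left or on the
    right clears its upper right block, and leaves one of the two determinants. *)
Lemma det_add1_mulmxC (R : comUnitRingType) m n (X : 'M[R]_(m, n))
    (Y : 'M[R]_(n, m)) :
  \det (1%:M + X *m Y) = \det (1%:M + Y *m X).
Proof.
pose Z := block_mx 1%:M (- X) Y 1%:M.
have := det_mulmx Z (block_mx 1%:M X 0 1%:M).
have := det_mulmx (block_mx 1%:M X 0 1%:M) Z.
rewrite !mulmx_block det_ublock !det1.
rewrite !(mul0mx, mul1mx, mulmx1, mulmx0, addr0, add0r, mul1r, mulr1).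
rewrite addNr addrN !det_lblock !det1 !mulr1 !mul1r => -> <-.
by rewrite [_ *m _ + _]addrC.
Qed.

Lemma det_mx2 (R : comPzRingType) (A : 'M[R]_(1 + 1)) :
  \det A = ulsubmx A 0 0 * drsubmx A 0 0 - ursubmx A 0 0 * dlsubmx A 0 0.
Proof.
rewrite (expand_det_row _ 0) !big_ord_recl big_ord0 addr0 /cofactor !det_mx11.
rewrite !mxE /=.
have -> : lift ord0 ord0 = rshift 1 0 :> 'I_(1 + 1) by apply: val_inj.
have -> : lift (rshift 1 0) 0 = lshift 1 0 :> 'I_(1 + 1) by apply: val_inj.
have -> : 0 = lshift 1 0 :> 'I_(1 + 1) by apply: val_inj.
rewrite expr0 expr1 mul1r mulN1r mulrN.
by congr (A _ _ * _ - _); apply: val_inj.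
Qed.

(** * Spectral properties of Gram matrices *)

Section Gram.
Variable C : numClosedFieldType.
Implicit Types (n r : nat).

Definition gram n r (B : 'M[C]_(n, r)) : 'M[C]_r := B^t* *m B.

Lemma gram_normal n r (B : 'M[C]_(n, r)) : gram B \is normalmx.
Proof.
by apply/normalmxP; rewrite /gram trmx_mul map_mxM trmxCK.
Qed.

Lemma gram_spectral n r (B : 'M[C]_(n, r)) (P := spectralmx (gram B)) :
  gram B = P^t* *m diag_mx (spectral_diag (gram B)) *m P.
Proof.
have /orthomx_spectralP {1}-> := gram_normal B.
by rewrite invmx_unitary ?spectral_unitarymx.
Qed.

Lemma gram_mulmx n r (B : 'M[C]_(n, r)) (L : 'M[C]_r) :
  gram (B *m L) = L^t* *m gram B *m L.
Proof. by rewrite /gram trmx_mul map_mxM !mulmxA. Qed.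

Lemma spectral_diag_gram_ge0 n r (B : 'M[C]_(n, r)) j :
  0 <= spectral_diag (gram B) 0 j.
Proof.
set P := spectralmx (gram B).
have PP : P *m P^t* = 1%:M by apply/unitarymxP/spectral_unitarymx.
(* An eigenvalue is the squared norm of a column of [B *m P^t*]. *)
have -> : spectral_diag (gram B) 0 j = gram (B *m P^t*) j j.
  rewrite gram_mulmx [in RHS]gram_spectral trmxCK -/P !mulmxA PP mul1mx.
  rewrite -mulmxA PP.
  by rewrite mulmx1 mxE eqxx.
by rewrite mxE sumr_ge0 // => k _; rewrite !mxE mulrC mul_conjC_ge0.
Qed.

Lemma det_gram n r (B : 'M[C]_(n, r)) :
  \det (gram B) = \prod_j spectral_diag (gram B) 0 j.
Proof.
set P := spectralmx (gram B).
have PP : P *m P^t* = 1%:M by apply/unitarymxP/spectral_unitarymx.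
rewrite {1}gram_spectral -/P !det_mulmx mulrAC -det_mulmx (mulmx1C PP).
by rewrite det1 mul1r det_diag.
Qed.

Lemma mxtrace_gram n r (B : 'M[C]_(n, r)) :
  \tr (gram B) = \sum_j spectral_diag (gram B) 0 j.
Proof.
set P := spectralmx (gram B).
have PP : P *m P^t* = 1%:M by apply/unitarymxP/spectral_unitarymx.
by rewrite {1}gram_spectral -/P mxtrace_mulC mulmxA PP mul1mx mxtrace_diag.
Qed.

Lemma det_gram_le_mxtrace n r (B : 'M[C]_(n, r)) :
  \det (gram B) <= (\tr (gram B) / r%:R) ^+ r.
Proof.
have := @leif_AGM C 'I_r predT (fun j => spectral_diag (gram B) 0 j).
rewrite cardT size_enum_ord => AGM.
rewrite det_gram mxtrace_gram.
by apply: AGM => j _; apply: spectral_diag_gram_ge0.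
Qed.

Lemma gram_normalize n r (B : 'M[C]_(n, r)) :
  \det (gram B) != 0 -> exists L : 'M[C]_r, gram (B *m L) = 1%:M.
Proof.
rewrite det_gram => /prodf_neq0 sp_neq0.
set P := spectralmx (gram B).
have PP : P *m P^t* = 1%:M by apply/unitarymxP/spectral_unitarymx.
pose s := spectral_diag (gram B).
(* [L] diagonalizes the Gram matrix, then rescales each eigenvector by the inverse square root of
   its nonzero eigenvalue. *)
pose d : 'rV[C]_r := \row_j (sqrtC (s 0 j))^-1.
exists (P^t* *m diag_mx d).
rewrite !mulmxA gram_mulmx (gram_mulmx _ (P^t*)) gram_spectral -/P -/s trmxCK.
have -> : P *m (P^t* *m diag_mx s *m P) *m P^t* = diag_mx s.
  by rewrite !mulmxA PP mul1mx -mulmxA PP mulmx1.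
have -> : (diag_mx d)^t* = diag_mx d.
  apply/matrixP=> i j; rewrite !mxE eq_sym.
  have [->|_] := eqVneq i j; last by rewrite !mulr0n conjC0.
  rewrite !mulr1n conj_Creal // ger0_real // invr_ge0 sqrtC_ge0.
  exact: spectral_diag_gram_ge0.
rewrite !mulmx_diag -diag_const_mx; congr diag_mx; apply/rowP => j.
rewrite !mxE.
rewrite mulrAC -invfM -expr2 sqrtCK mulVf //; exact: sp_neq0.
Qed.

Lemma det_gram_mulmx n r (B : 'M[C]_(n, r)) (L : 'M[C]_r) :
  \det (gram (B *m L)) = `|\det L| ^+ 2 * \det (gram B).
Proof.
by rewrite gram_mulmx !det_mulmx det_map_mx det_tr normCKC mulrAC.
Qed.

Lemma gram_sum_row n r (B : 'M[C]_(n, r)) :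
  gram B = \sum_j gram (row j B).
Proof.
apply/matrixP=> a b; rewrite summxE !mxE; apply: eq_bigr => j _.
by rewrite !mxE big_ord1 !mxE.
Qed.

Lemma mxtrace_gram_row n r (B : 'M[C]_(n, r)) :
  \tr (gram B) = \sum_i (B *m B^t*) i i.
Proof. by rewrite /gram mxtrace_mulC. Qed.

Lemma mulmx_trmxC_conj m n p (A : 'M[C]_(m, p)) (B : 'M[C]_(n, p)) i j :
  (B *m A^t*) j i = ((A *m B^t*) i j)^*.
Proof.
by rewrite -[in LHS](trmxCK B) -map_mxM -trmx_mul !mxE.
Qed.

(** A swap is a rank-two update, which Sylvester's identity reduces to a 2 by 2 determinant; its
    off-diagonal entries multiply to a squared modulus because the inner products are conjugate. *)
Lemma det_swap_row r (u v : 'rV[C]_r) :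
  \det (1%:M + gram u - gram v) =
    (1 + (u *m u^t*) 0 0) * (1 - (v *m v^t*) 0 0) + `|(u *m v^t*) 0 0| ^+ 2.
Proof.
have -> : 1%:M + gram u - gram v =
    1%:M + row_mx (u^t*) (- v^t*) *m col_mx u v.
  by rewrite mul_row_col mulNmx addrA.
rewrite det_add1_mulmxC mul_col_row scalar_mx_block add_block_mx.
rewrite det_mx2 block_mxKul block_mxKur block_mxKdl block_mxKdr !add0r !mulmxN.
have addE (M M' : 'M[C]_1) : (M + M') 0 0 = M 0 0 + M' 0 0 by rewrite mxE.
have oppE (M : 'M[C]_1) : (- M) 0 0 = - M 0 0 by rewrite mxE.
rewrite !addE !oppE.
rewrite [(v *m u^t*) 0 0]mulmx_trmxC_conj normCK [1%:M 0 0]mxE /= mulr1n.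
by ring.
Qed.

End Gram.

(** * Volumes as Gram determinants *)

Section Volume.
Variable R : realType.
Implicit Types (n r : nat).

Lemma volume_ge0 n r (B : 'M[R[i]]_(n, r)) : 0 <= volume B.
Proof.
apply: prodr_ge0 => i _.
have [lt_i|ge_i] := ltnP i (size (singular_values B));
  last by rewrite nth_default.
have := mem_nth 0 lt_i; rewrite {2}/singular_values mem_sort.
by case/imageP => j _ ->; apply: sqrtr_ge0.
Qed.

(** With [r <= n] the product takes in all [r] singular values, so their order is irrelevant. *)
Lemma volume_sqr n r (B : 'M[R[i]]_(n, r)) :
  (r <= n)%N -> ((volume B ^+ 2)%:C)%C = \det (gram B).
Proof.
move=> le_rn; rewrite det_gram /volume (minn_idPr le_rn).
have -> : \prod_(i < r) (singular_values B)`_i =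
    \prod_(x <- singular_values B) x.
  rewrite (big_nth 0) big_mkord /singular_values size_sort size_map.
  by rewrite size_enum_ord.
rewrite (perm_big _ (permEl (perm_sort _ _))) big_image /=.
rewrite -prodrXl rmorph_prod; apply: eq_bigr => j _.
have sp_ge0 := spectral_diag_gram_ge0 B j.
rewrite sqr_sqrtr; first by apply: RRe_real; rewrite ger0_real.
by move: sp_ge0; rewrite lecE => /andP[].
Qed.

End Volume.

(** * Trace bound from the swap conditions *)

Lemma gram_rowsub_swap (C : numClosedFieldType) N n r (A : 'M[C]_(N, r))
    (f : 'I_n -> 'I_N) (k : 'I_n) (i : 'I_N) :
  gram (rowsub [eta f with k |-> i] A) =
    gram (rowsub f A) + gram (row i A) - gram (row (f k) A).
Proof.
rewrite (gram_sum_row (rowsub [eta f with k |-> i] A)).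
rewrite (gram_sum_row (rowsub f A)).
rewrite (bigD1 k) //= [in RHS](bigD1 k) //= !row_rowsub /= eqxx.
rewrite [RHS]addrAC [X in _ = X + _]addrAC subrr add0r [RHS]addrC.
by congr (_ + _); apply: eq_bigr => j /negPf jk; rewrite !row_rowsub /= jk.
Qed.

Lemma mxtrace_gram_rowsub_le (R : realType) N n r (A : 'M[R[i]]_(N, r))
    (f g : 'I_n -> 'I_N) :
  (r <= n)%N -> injective f -> injective g -> gram (rowsub f A) = 1%:M ->
  (forall (k : 'I_n) (i : 'I_N), i \notin codom f ->
     \det (gram (rowsub [eta f with k |-> i] A)) <= 1) ->
  \tr (gram (rowsub g A)) <=
    ((r%:R * (n%:R + 1) / (n%:R - r%:R + 1))%:C)%C.
Proof.
move=> le_rn f_inj g_inj gramf detP.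
pose G := A *m A^t*.
have G_rows i k : (row i A *m (row k A)^t*) 0 0 = G i k.
  by rewrite !mxE; apply: eq_bigr => j _; rewrite !mxE.
have normG i k : `|G i k| ^+ 2 = (complex.Re (`|G i k| ^+ 2))%:C%C.
  by rewrite RRe_real // ger0_real // exprn_ge0.
have G_ge0 i : 0 <= G i i.
  by rewrite mxE sumr_ge0 // => k _; rewrite !mxE mul_conjC_ge0.
have ReG i : G i i = (complex.Re (G i i))%:C%C.
  by rewrite RRe_real // ger0_real.
have trg h : \tr (gram (rowsub h A)) = \sum_(j < n) G (h j) (h j).
  rewrite mxtrace_gram_row; apply: eq_bigr => j _.
  by rewrite !mxE; apply: eq_bigr => l _; rewrite !mxE.
have sum_img h (F : 'I_N -> R) : injective h ->
    \sum_(i in h @: [set: 'I_n]) F i = \sum_(j < n) F (h j).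
  move=> h_inj; rewrite big_imset /=; last by move=> ? ? _ _ /h_inj.
  by apply: eq_bigl => j; rewrite inE.
have card_img (h : 'I_n -> 'I_N) : injective h -> #|h @: [set: 'I_n]| = n.
  by move=> h_inj; rewrite card_imset // cardsT card_ord.
have q_gt0 : 0 < n%:R - r%:R + 1 :> R.
  by rewrite ltr_wpDl // subr_ge0 ler_nat.
rewrite trg (eq_bigr _ (fun j _ => ReG (g j))) -rmorph_sum lecR ler_pdivlMr //.
rewrite -(sum_img g (fun i => complex.Re (G i i))) //.
apply: (@swap_sum_le _ _ (f @: setT) _ _ _ _
  (fun i k => complex.Re (`|G i k| ^+ 2))); rewrite ?card_img //.
- by move=> i; rewrite -lecR -ReG.
- by move=> i k; rewrite -lecR -normG exprn_ge0.
- apply: complexI; rewrite sum_img // rmorph_sum rmorph_nat.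
  rewrite -(eq_bigr _ (fun j _ => ReG (f j))) -trg gramf.
  by rewrite mxtrace1.
- move=> i; apply: complexI; rewrite sum_img // rmorph_sum -ReG.
  rewrite -(eq_bigr _ (fun j _ => normG i (f j))).
  (* Inserting the identity [gram (rowsub f A)] between the two factors of [G] expands [G i i] over
     the rows [f j]. *)
  have -> : G i i = (A *m gram (rowsub f A) *m A^t*) i i.
    by rewrite gramf mulmx1.
  rewrite /gram mulmxA -mulmxA mxE; apply: eq_bigr => j _.
  rewrite [X in _ * X]mulmx_trmxC_conj -normCK; congr (`|_| ^+ 2).
  by rewrite !mxE; apply: eq_bigr => l _; rewrite !mxE.
move=> i _ iNf /imsetP[k _ ->]; rewrite -lecR.
rewrite rmorphD rmorphM rmorphD rmorphB /=.
rewrite -normG -!ReG -!G_rows -det_swap_row -gramf -gram_rowsub_swap.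
apply: detP; apply: contra iNf => /codomP[j ->]; exact: imset_f.
Qed.

(** * Normalization and the volume bound *)

Theorem theorem1 (R : realType) (N n r : nat) (A : 'M[R[i]]_(N, r))
    (rows_hat rows_M : 'I_n -> 'I_N)
    (le_rn : (r <= n)%N) (le_nN : (n <= N)%N)
    (hat_inj : injective rows_hat)
    (hat_neq0 : volume (rowsub rows_hat A) != 0)
    (hat_max : forall (k : 'I_n) (i : 'I_N), i \notin codom rows_hat ->
       volume (rowsub [eta rows_hat with k |-> i] A)
         <= volume (rowsub rows_hat A))
    (M_inj : injective rows_M)
    (M_max : forall rows : 'I_n -> 'I_N, injective rows ->
       volume (rowsub rows A) <= volume (rowsub rows_M A)) :
  volume (rowsub rows_M A)
    <= volume (rowsub rows_hat A)
       * ((n%:R + 1) / (n%:R - r%:R + 1)) `^ (r%:R / 2).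
Proof.
have [|L gramL] := @gram_normalize _ _ _ (rowsub rows_hat A).
  rewrite -volume_sqr // -(rmorph0 (real_complex R)).
  by rewrite (inj_eq (@complexI _)) expf_neq0.
(* [d] is the common factor by which [L] scales squared volumes; it makes that of the dominant rows
   1. *)
pose C := A *m L; pose d := complex.Re (`|\det L| ^+ 2).
have dE : `|\det L| ^+ 2 = (d%:C)%C.
  by rewrite RRe_real // ger0_real // exprn_ge0.
have detC (f : 'I_n -> 'I_N) : \det (gram (rowsub f C)) =
    ((d * volume (rowsub f A) ^+ 2)%:C)%C.
  by rewrite rmorphM /= -dE volume_sqr // /C -mul_rowsub_mx det_gram_mulmx.
have gramC : gram (rowsub rows_hat C) = 1%:M by rewrite /C -mul_rowsub_mx.
have dhat : d * volume (rowsub rows_hat A) ^+ 2 = 1.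
  by apply: complexI; rewrite -detC gramC det1.
have d_ge0 : 0 <= d by rewrite -lecR -dE exprn_ge0.
have trM : \tr (gram (rowsub rows_M C)) <=
    ((r%:R * (n%:R + 1) / (n%:R - r%:R + 1))%:C)%C.
  apply: (mxtrace_gram_rowsub_le le_rn hat_inj M_inj gramC) => k i iNhat.
  rewrite detC -(rmorph1 (real_complex R)) lecR -[leRHS]dhat.
  apply: (ler_wpM2l d_ge0); apply: lerXn2r; last exact: hat_max.
    exact: volume_ge0.
  exact: volume_ge0.
set K := (n%:R + 1) / (n%:R - r%:R + 1).
have K_ge0 : 0 <= K.
  by rewrite divr_ge0 // addr_ge0 ?subr_ge0 ?ler_nat ?ler0n ?ler01.
have dM : d * volume (rowsub rows_M A) ^+ 2 <= K ^+ r.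
  rewrite -lecR -detC; apply: le_trans (det_gram_le_mxtrace _) _.
  (* For [r = 0] the mean divides by zero, but both powers are 1. *)
  have [r0|r_neq0] := eqVneq r 0%N.
    by move: (\tr _) => x; rewrite r0 !expr0.
  rewrite rmorphXn ler_pXn2r ?nnegrE ?divr_ge0 ?ler0n ?ler0c ?lt0n //.
    rewrite ler_pdivrMr ?ltr0n ?lt0n //; apply: le_trans trM _.
    by rewrite -mulrA -/K rmorphM rmorph_nat mulrC.
  by rewrite mxtrace_gram sumr_ge0 // => j _; apply: spectral_diag_gram_ge0.
have d_gt0 : 0 < d.
  rewrite lt_def d_ge0 andbT; apply: contra_eq_neq dhat => ->.
  by rewrite mul0r eq_sym oner_neq0.
have K_sqr : (K `^ (r%:R / 2)) ^+ 2 = K ^+ r.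
  by rewrite -powR_mulrn ?powR_ge0 // -powRrM mulfVK ?pnatr_eq0 // powR_mulrn.
move: dM dhat (volume_ge0 (rowsub rows_hat A)) (volume_ge0 (rowsub rows_M A)).
move: (volume (rowsub rows_hat A)) (volume (rowsub rows_M A)) => vhat vM.
move=> dM dhat vhat_ge0 vM_ge0.
(* Both sides are nonnegative, so their squares may be compared, scaled by [d]. *)
rewrite -(@ler_pXn2r _ 2) ?nnegrE ?mulr_ge0 ?powR_ge0 // -(ler_pM2l d_gt0).
by rewrite exprMn K_sqr [leRHS]mulrA dhat mul1r.
Qed.
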